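(* Let $b\in\mathbb{R}^n\setminus\mathbb{Z}^n$ and let $S=b+\mathbb{Z}^n$. Then every maximal $S$-free convex set is a polyhedron. Moreover, if a maximal $S$-free polyhedron $K\subseteq\mathbb{R}^n$ with $0\in\operatorname{int}(K)$ is given by $K=\{x\in\mathbb{R}^n : a_ix\le 1 \text{ for all } i\in I\}$ for some finite set $I$ (with $a_i\in\mathbb{R}^n$ for $i\in I$), then the gauge $\psi$ of $K$ is given by $$\psi(r)=\max_{i\in I}a_ir\qquad\text{for every } r\in\mathbb{R}^n.$$
   Context: A closed convex set $K\subseteq\mathbb{R}^n$ is $S$-free if $\operatorname{int}(K)\cap S=\emptyset$, where $\operatorname{int}$ denotes topological interior. An $S$-free convex set is maximal if it is not properly contained in any $S$-free (closed) convex set. For a closed convex set $K\subseteq\mathbb{R}^n$ with $0\in\operatorname{int}(K)$, the gauge of $K$ is the function $\gamma_K:\mathbb{R}^n\to\mathbb{R}$ defined by $\gamma_K(r)=\inf\{t>0 : r/t\in K\}$. The product $a_ix$ denotes the scalar product of $a_i$ and $x$. *)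

(* Defs.v *)
From mathcomp Require Import all_boot all_order all_algebra.
From mathcomp Require Import all_classical all_reals all_analysis.

Set Implicit Arguments.
Unset Strict Implicit.
Unset Printing Implicit Defensive.

Import Order.TTheory GRing.Theory Num.Theory numFieldNormedType.Exports.

Local Open Scope classical_set_scope.
Local Open Scope ring_scope.

Definition dotp (R : realType) (n : nat) (u v : 'rV[R]_n) : R :=
  \sum_(j < n) u 0 j * v 0 j.

Definition Zvec (R : realType) (n : nat) : set 'rV[R]_n :=
  [set z | z \is a mxOver Num.int].

Definition translated_lattice (R : realType) (n : nat) (b : 'rV[R]_n) :
  set 'rV[R]_n := [set b + z | z in @Zvec R n].

Definition S_free (R : realType) (n : nat) (S K : set 'rV[R]_n) : Prop :=
  [/\ closed K, convex_set K & interior K `&` S = set0].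

Definition maximal_S_free (R : realType) (n : nat) (S K : set 'rV[R]_n) :
  Prop :=
  S_free S K /\ ~ (exists2 L : set 'rV[R]_n, S_free S L & K `<` L).

Definition polyhedron (R : realType) (n : nat) (K : set 'rV[R]_n) : Prop :=
  exists (m : nat) (c : 'I_m -> 'rV[R]_n) (d : 'I_m -> R),
    K = [set x | forall i, dotp (c i) x <= d i].

(* [inf] is real-valued; the set below is nonempty as soon as 0 is an interior
   point of K, the only case in which the gauge is considered. *)
Definition gauge (R : realType) (n : nat) (K : set 'rV[R]_n) (r : 'rV[R]_n) :
  R := inf [set t : R | 0 < t /\ K (t^-1 *: r)].

Definition is_max (R : realType) (A : set R) (m : R) : Prop :=
  A m /\ ubound A m.

(* Main.v *)
(* A maximal S-free set without interior points is a hyperplane. Otherwise fix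
   an interior point x0. By separation, each lattice point s gives a vector a
   in the polar A of K - x0 with a.(s - x0) >= 1. For the lattice points in a
   box, a parity argument (Doignon, Bell, Scarf) shows that 2^n vectors of A
   are enough. A is compact, so these 2^n-tuples accumulate as the box grows,
   and the limit tuple cuts out an S-free polyhedron containing K, hence equal
   to K by maximality. For the gauge formula, a direction r with a_i.r < 0 for
   all i would give K arbitrarily large balls, hence a point of S in its
   interior; thus the maximum of the a_i.r is nonnegative. *)

Require Import Defs.
From mathcomp Require Import all_boot all_order all_algebra.
From mathcomp Require Import all_classical all_reals all_analysis.
From mathcomp Require Import zify ring lra.

Set Implicit Arguments.
Unset Strict Implicit.
Unset Printing Implicit Defensive.

Import Order.TTheory GRing.Theory Num.Theory numFieldNormedType.Exports.

Local Open Scope classical_set_scope.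
Local Open Scope ring_scope.

(** * The scalar product: algebra, continuity, compactness of bounded closed sets *)

Section DotProduct.
Context {R : realType} {n : nat}.
Implicit Types (u v w : 'rV[R]_n) (t : R).

Lemma dotpC u v : dotp u v = dotp v u.
Proof. by apply: eq_bigr => j _; rewrite mulrC. Qed.

Lemma dotpDr u v w : dotp u (v + w) = dotp u v + dotp u w.
Proof. by rewrite -big_split; apply: eq_bigr => j _; rewrite mxE mulrDr. Qed.

Lemma dotpZr u t v : dotp u (t *: v) = t * dotp u v.
Proof.
by rewrite mulr_sumr; apply: eq_bigr => j _; rewrite mxE mulrCA.
Qed.

Lemma dotpNr u v : dotp u (- v) = - dotp u v.
Proof. by rewrite -scaleN1r dotpZr mulN1r. Qed.

Lemma dotpBr u v w : dotp u (v - w) = dotp u v - dotp u w.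
Proof. by rewrite dotpDr dotpNr. Qed.

Lemma dotpZl u t v : dotp (t *: u) v = t * dotp u v.
Proof. by rewrite dotpC dotpZr dotpC. Qed.

Lemma dotpNl u v : dotp (- u) v = - dotp u v.
Proof. by rewrite dotpC dotpNr dotpC. Qed.

Lemma dotp0l v : dotp 0 v = 0.
Proof. by rewrite -(scale0r v) dotpZl mul0r. Qed.

Lemma dotp_sqrB u v : dotp (u - v) (u - v) = dotp u u - 2 * dotp v u + dotp v v.
Proof. by rewrite dotpBr !(dotpC (u - v)) !dotpBr (dotpC u v); ring. Qed.

Lemma dotp_trcol m (B : 'M[R]_(n, m)) v j : dotp (col j B)^T v = (v *m B) 0 j.
Proof. by rewrite dotpC mxE; apply: eq_bigr => k _; rewrite !mxE. Qed.

Lemma dotp_delta u j : dotp u (delta_mx 0 j) = u 0 j.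
Proof.
rewrite /dotp (bigD1 j)//= big1 ?addr0 => [|k kj].
  by rewrite mxE !eqxx mulr1.
by rewrite mxE (negPf kj) andbF mulr0.
Qed.

Lemma sqr_coord_le_dotp u j : u 0 j ^+ 2 <= dotp u u.
Proof.
rewrite /dotp (bigD1 j)//= -expr2 lerDl; apply: sumr_ge0 => k _.
by rewrite -expr2 sqr_ge0.
Qed.

Lemma dotp_ge0 u : 0 <= dotp u u.
Proof. by apply: sumr_ge0 => j _; rewrite -expr2 sqr_ge0. Qed.

Lemma dotp_gt0 u : u != 0 -> 0 < dotp u u.
Proof.
move=> u0; rewrite lt_def dotp_ge0 andbT; apply: contra u0 => /eqP u0.
apply/eqP/rowP => j; rewrite mxE; apply/eqP.
by rewrite -sqrf_eq0 eq_le sqr_ge0 -u0 sqr_coord_le_dotp.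
Qed.

Lemma cvg_dotp {T : Type} {F : set_system T} {FF : Filter F}
    (f g : T -> 'rV[R]_n) u v :
  f @ F --> u -> g @ F --> v -> dotp (f x) (g x) @[x --> F] --> dotp u v.
Proof.
move=> fu gv; apply: cvg_big => [|j _]; first exact: add_continuous.
apply: cvgM.
  exact: (cvg_comp f (fun M : 'rV[R]_n => M 0 j) fu
    (@coord_continuous R 1 n 0 j u)).
exact: (cvg_comp g (fun M : 'rV[R]_n => M 0 j) gv
  (@coord_continuous R 1 n 0 j v)).
Qed.

Lemma dotp_continuous u : continuous (dotp u).
Proof.
move=> x; apply: (@cvg_dotp _ (nbhs x) _ (fun=> u) id); first exact: cvg_cst.
exact: cvg_id.
Qed.

Lemma near_dotp_lt u v (d : R) :
  dotp u v < d -> \forall x \near v, dotp u x < d.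
Proof. exact: (cvgr_lt _ (@dotp_continuous u v)). Qed.

Lemma near_dotp_gt u v (d : R) :
  d < dotp u v -> \forall x \near v, d < dotp u x.
Proof. exact: (cvgr_gt _ (@dotp_continuous u v)). Qed.

Lemma compact_bounded_coord (A : set 'rV[R]_n) (M : R) :
  closed A -> (forall a, A a -> forall j, `|a 0 j| <= M) -> compact A.
Proof.
move=> cA AM.
apply: (@subclosed_compact _ A
  [set v : 'rV[R]_n | forall j, `[- M, M]%classic (v ord0 j)]) => //.
  apply: (@rV_compact R n (fun=> `[- M, M]%classic)) => j.
  exact: segment_compact.
by move=> a Aa j /=; rewrite in_itv/= -ler_norml; exact: AM.
Qed.

End DotProduct.

(** * Segments and interior points of convex sets *)

Section ConvexSets.
Context {R : realType} {n : nat}.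
Implicit Types (K : set 'rV[R]_n) (x y : 'rV[R]_n).

Lemma convex_segment K x y (t : R) : convex_set K -> K x -> K y ->
  0 <= t <= 1 -> K (t *: x + (1 - t) *: y).
Proof.
move=> cK Kx Ky /andP[t0 t1].
by have := cK x y (Itv01 t0 t1); rewrite !inE; exact.
Qed.

Lemma segment_convex K :
  (forall x y (t : R), K x -> K y -> 0 <= t <= 1 ->
    K (t *: x + (1 - t) *: y)) ->
  convex_set K.
Proof.
move=> cK x y t; rewrite !inE => Kx Ky.
by apply: (cK x y t%:num) => //; rewrite ge0 le1.
Qed.

Lemma interior_line K x v : interior K x ->
  exists2 e : R, 0 < e & forall t, `|t| <= e -> K (x + t *: v).
Proof.
move=> Kx; have c : (x + t *: v) @[t --> (0:R)] --> x.
  rewrite -[X in _ --> X]addr0 -(scale0r v).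
  by apply: cvgD; [exact: cvg_cst|apply: cvgZr_tmp; exact: cvg_id].
have /nbhs_ballP[e /= e0 eK] := c _ Kx.
exists (e / 2) => [|t te]; first by rewrite divr_gt0.
by apply: eK; rewrite /ball/= sub0r normrN; lra.
Qed.

(** For [z] near the given point, [(1 - t)^-1 *: (z - t *: y)] is near [x], hence in [K], and [z] is
    a convex combination of it and [y]. *)
Lemma interior_segment K x y (t : R) : convex_set K -> interior K x -> K y ->
  0 <= t < 1 -> interior K (t *: y + (1 - t) *: x).
Proof.
move=> cK Kx Ky /andP[t0 t1].
set s := t *: y + (1 - t) *: x.
have t1n : 1 - t != 0 by rewrite subr_eq0 gt_eqF.
have c : ((1 - t)^-1 *: (z - t *: y)) @[z --> s] --> x.
  have <- : (1 - t)^-1 *: (s - t *: y) = x.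
    by rewrite /s addrAC subrr add0r scalerA mulVf// scale1r.
  have c : (z - t *: y) @[z --> s] --> s - t *: y.
    by apply: (@cvgB _ _ _ _ (nbhs_filter _)); [exact: cvg_id|exact: cvg_cst].
  exact: cvgZl_tmp c.
apply: (@filterS _ _ (nbhs_filter s) _ _ _ (c _ Kx)) => z /= Kz.
have -> : z = t *: y + (1 - t) *: ((1 - t)^-1 *: (z - t *: y)).
  by rewrite scalerA divff// scale1r addrC subrK.
by apply: convex_segment => //; rewrite t0 ltW.
Qed.

End ConvexSets.

(** * Nearest points, separation and polars *)

Section Separation.
Context {R : realType} {n : nat}.
Implicit Types (K : set 'rV[R]_n) (x y : 'rV[R]_n).

Lemma closed_halfspace (a : 'rV[R]_n) (d : R) : closed [set x | dotp a x <= d].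
Proof.
have /continuous_closedP /(_ _ (@closed_le R d)) := @dotp_continuous R n a.
exact.
Qed.

(** The squared distance is minimised over the compact part of [K] that is no farther from [y] than
    a chosen point [z]. *)
Lemma exists_nearest_point K y : closed K -> K !=set0 ->
  exists2 p, K p &
    forall x, K x -> dotp (p - y) (p - y) <= dotp (x - y) (x - y).
Proof.
move=> cK [z Kz].
pose f x := dotp (x - y) (x - y).
have cf : continuous f.
  move=> x; have c : (w - y) @[w --> x] --> x - y.
    by apply: (@cvgB _ _ _ _ (nbhs_filter _)); [exact: cvg_id|exact: cvg_cst].
  exact: (@cvg_dotp _ _ _ (nbhs x) _ _ _ _ _ c c).
pose D := K `&` [set x | f x <= f z].
have cD : compact D.
  apply: (@compact_bounded_coord _ _ _ (f z + 1 + \sum_j `|y 0 j|)).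
    apply: closedI => //.
    by have /continuous_closedP /(_ _ (@closed_le R (f z))) := cf.
  move=> a [_ /= fa] j.
  have h1 : (a 0 j - y 0 j) ^+ 2 <= f z.
    by have := sqr_coord_le_dotp (a - y) j; rewrite !mxE => /le_trans; exact.
  have h2 : `|a 0 j - y 0 j| <= f z + 1.
    rewrite -real_normK ?num_real// in h1.
    have := normr_ge0 (a 0 j - y 0 j); move: h1; set u := `|_| => h1 u0.
    (* A bound without square roots: [u] is at most 1, or else at most its square. *)
    have [u1|u1] := leP u 1.
      by have := dotp_ge0 (z - y); rewrite -/(f z); lra.
    by nra.
  rewrite -(subrK (y 0 j) (a 0 j)) (le_trans (ler_normD _ _))// lerD//.
  by rewrite (bigD1 j)//= lerDl sumr_ge0.
have D0 : D !=set0 by exists z; split; rewrite /=.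
have [|p] := EVT_min_rV D0 cD (f := f).
  by apply: continuous_subspaceT.
rewrite inE => -[Kp fp] pm; exists p => // x Kx.
have [xz|/ltW zx] := leP (f x) (f z); first by apply: pm; rewrite inE.
exact: le_trans zx.
Qed.

(** The normal is [y - p] with [p] nearest to [y]: a point [x] of [K] beyond the hyperplane through
    [p] would let one approach [y] by moving from [p] towards [x]. *)
Lemma separate_point K y : closed K -> convex_set K -> ~ K y ->
  exists c d, (forall x, K x -> dotp c x <= d) /\ d < dotp c y.
Proof.
move=> cK xK Ky.
have [K0|/set0P/(exists_nearest_point y cK)[p Kp pm]] := eqVneq K set0.
  by exists 0, (-1); split => [x|]; rewrite ?K0// dotp0l ltrN10.
have yp : y - p != 0.
  by rewrite subr_eq0; apply: contra_notN Ky => /eqP ->.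
exists (y - p), (dotp (y - p) p); split => [x Kx|]; last first.
  by rewrite -subr_gt0 -dotpBr dotp_gt0.
rewrite -subr_le0 -dotpBr leNgt; apply/negP.
set v := x - p; set m := dotp (y - p) v => m0.
have v0 : v != 0.
  by apply: contraTN m0 => /eqP v0; rewrite /m v0 dotpC dotp0l ltxx.
have vv := dotp_gt0 v0.
have key t : 0 <= t <= 1 -> 0 <= t ^+ 2 * dotp v v - 2 * t * m.
  move=> t01; have := pm _ (convex_segment xK Kx Kp t01).
  have -> : t *: x + (1 - t) *: p - y = t *: v - (y - p).
    by apply/rowP => j; rewrite !mxE; ring.
  rewrite -[p - y]opprB dotpNl dotpNr opprK.
  rewrite (dotp_sqrB (t *: v)) !dotpZr dotpZl -/m.
  by move: (dotp (y - p) _) => ?; lra.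
(* The quadratic in [key] is least at [m / dotp v v], where it is negative; if that exceeds 1, the
   endpoint 1 already gives a negative value. *)
have [mv|mv] := leP m (dotp v v).
  have /key : 0 <= m / dotp v v <= 1.
    by rewrite divr_ge0 ?ler_pdivrMr// ?mul1r ?mv// ltW.
  set q := dotp v v in vv mv *.
  have -> : (m / q) ^+ 2 * q - 2 * (m / q) * m = - (m ^+ 2 / q).
    by field; rewrite gt_eqF.
  by rewrite oppr_ge0 leNgt divr_gt0// exprn_gt0.
have /key : 0 <= (1:R) <= 1 by rewrite ler01 lexx.
by lra.
Qed.

Definition polar_at K x0 : set 'rV[R]_n :=
  [set a | forall x, K x -> dotp a (x - x0) <= 1].

Lemma polar_at_separates K x0 y : closed K -> convex_set K -> interior K x0 ->
  ~ K y -> exists2 a, polar_at K x0 a & 1 <= dotp a (y - x0).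
Proof.
move=> cK xK ix Ky.
have [c [d [Kd dy]]] := separate_point cK xK Ky.
have Kx0 : K x0 by exact: interior_subset ix.
have c0 : c != 0.
  apply: contraTN dy => /eqP c0; rewrite -leNgt c0 dotp0l.
  by have := Kd _ Kx0; rewrite c0 dotp0l.
have [e e0 eK] := interior_line c ix.
(* The point [x0 + e *: c] of [K] shows that the slack at [x0] is at least [e * dotp c c]; dividing
   [c] by the slack puts it in the polar. *)
have h0 : 0 < d - dotp c x0.
  have := Kd _ (eK e (eqbRL (ler_norml _ _) _)).
  rewrite lexx andbT (le_trans _ (ltW e0)) ?oppr_le0 ?(ltW e0)//.
  move=> /(_ isT); rewrite dotpDr dotpZr.
  by have := mulr_gt0 e0 (dotp_gt0 c0); lra.
exists ((d - dotp c x0)^-1 *: c) => [x Kx|]; rewrite dotpZl dotpBr mulrC.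
  by rewrite ler_pdivrMr// mul1r lerD2r Kd.
by rewrite ler_pdivlMr// mul1r lerD2r ltW.
Qed.

Lemma polar_at_closed K x0 : closed (polar_at K x0).
Proof.
have -> : polar_at K x0 = \bigcap_(x in K) [set a | dotp (x - x0) a <= 1].
  by apply/seteqP; split => a /= h x Kx; have := h x Kx; rewrite /= dotpC.
by apply: closed_bigI => x Kx; exact: closed_halfspace.
Qed.

(** [K] contains a segment of half-length [e j] around [x0] in each coordinate direction, which
    bounds the coordinate [j] of a polar vector by [(e j)^-1]. *)
Lemma polar_at_compact K x0 : interior K x0 -> compact (polar_at K x0).
Proof.
move=> ix.
have /choice[e eP] (j : 'I_n) : exists e : R, 0 < e /\
    forall t, `|t| <= e -> K (x0 + t *: delta_mx 0 j).
  by have [e e0 eK] := interior_line (delta_mx 0 j) ix; exists e.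
apply: (@compact_bounded_coord _ _ _ (\sum_j (e j)^-1)).
  exact: polar_at_closed.
move=> a aK j; have [e0 eK] := eP j.
apply: (@le_trans _ _ (e j)^-1); last first.
  rewrite (bigD1 j)//= lerDl sumr_ge0// => k _.
  by rewrite invr_ge0 ltW//; have [] := eP k.
have h t : `|t| <= e j -> t * a 0 j <= 1.
  move=> /eK/aK; rewrite addrC addKr dotpZr dotp_delta; exact.
have h1 : e j * a 0 j <= 1 by apply: h; rewrite ger0_norm// ltW.
have h2 : - e j * a 0 j <= 1 by apply: h; rewrite normrN ger0_norm// ltW.
rewrite -[_^-1]div1r ler_pdivlMr// -(ger0_norm (ltW e0)) -normrM ler_norml.
by apply/andP; split; lra.
Qed.

Lemma polar_at0 K x0 : polar_at K x0 0.
Proof. by move=> x _; rewrite dotp0l ler01. Qed.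

Lemma polar_atZ K x0 a (t : R) : 0 <= t <= 1 ->
  polar_at K x0 a -> polar_at K x0 (t *: a).
Proof.
move=> /andP[t0 t1] aK x Kx; rewrite dotpZl.
by rewrite (le_trans (ler_wpM2l t0 (aK _ Kx)))// mulr1.
Qed.

End Separation.

(** * Coverings of a finite coloured point set by few vectors *)

Section MidpointCovering.
Context {R : realType} {n : nat} {F C : finType}.
Variables (pt : F -> 'rV[R]_n) (col : F -> C) (A : set 'rV[R]_n).
Hypothesis A0 : A 0.
Hypothesis AZ : forall a (t : R), 0 <= t <= 1 -> A a -> A (t *: a).
Hypothesis midpoint : forall s t, col s = col t ->
  exists p, pt p = 2^-1 *: (pt s + pt t).

Let covers (a : 'rV[R]_n) s := 1 <= dotp a (pt s).
(** The vectors are indexed by the points themselves, so choosing one vector per point gives a first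
    covering. *)
Let covering (f : F -> 'rV[R]_n) :=
  (forall i, A (f i)) /\ forall s, exists i, covers (f i) s.
Let private (g : F -> 'rV[R]_n) i s :=
  covers (g i) s /\ forall j, j != i -> ~~ covers (g j) s.
Let tight (g : F -> 'rV[R]_n) i s := private g i s /\
  forall t, covers (g i) t -> dotp (g i) (pt s) <= dotp (g i) (pt t).
Let incidence (f : F -> 'rV[R]_n) := #|[pred x : F * F | covers (f x.1) x.2]|.

Lemma minimal_covering f : covering f ->
  exists2 g, covering g &
    forall h, covering h -> (incidence g <= incidence h)%N.
Proof.
move=> cf.
have ex : exists k, `[< exists2 g, covering g & incidence g = k >].
  by exists (incidence f); apply/asboolP; exists f.
case: (ex_minnP ex) => k /asboolP[g cg <-] gmin.
by exists g => // h ch; apply: gmin; apply/asboolP; exists h.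
Qed.

Section Minimal.
Variable g : F -> 'rV[R]_n.
Hypotheses (cg : covering g)
  (gmin : forall h, covering h -> (incidence g <= incidence h)%N).

(** Putting [a] in place of [g i] leaves a covering, since a point not private to [i] is covered by
    another vector; losing an incidence would contradict minimality. *)
Lemma minimal_covering_irreplaceable i a : A a ->
  (forall s, covers a s -> covers (g i) s) ->
  (forall s, private g i s -> covers a s) ->
  forall s, covers (g i) s -> covers a s.
Proof.
move=> Aa ag pa s gs; apply/negPn/negP => as_.
pose h j := if j == i then a else g j.
have ch : covering h.
  split=> [j|t]; first by rewrite /h; case: ifP => // _; have [] := cg.
  have [[j [ji gj]]|nj] := pselect (exists j, j != i /\ covers (g j) t).
    by exists j; rewrite /h (negPf ji).
  exists i; rewrite /h eqxx; apply: pa.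
  have nj' j : j != i -> ~~ covers (g j) t.
    by move=> ji; apply/negP => gj; apply: nj; exists j.
  split=> //; have [_ /(_ t)[j gj]] := cg.
  have [<-//|/nj'] := eqVneq j i; by rewrite gj.
have := gmin ch; rewrite leqNgt => /negP; apply; apply: proper_card.
apply/properP; split.
  apply/fintype.subsetP => -[j t]; rewrite !inE /h /=.
  by case: ifP => // /eqP ->; exact: ag.
by exists (i, s); rewrite inE /h /= ?eqxx.
Qed.

(** A used vector has a private point, as otherwise 0 could replace it. Let [mu] be its least value
    on private points; dividing by [mu] keeps these covered, so by irreplaceability every point it
    covers has value at least [mu]. *)
Lemma minimal_covering_tight i : (exists s, covers (g i) s) ->
  exists s, tight g i s.
Proof.
move=> [s0 gs0].
have [s1 ps1] : exists s, private g i s.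
  apply: contrapT => np.
  have := @minimal_covering_irreplaceable i 0 A0 _ _ s0 gs0.
  rewrite /covers dotp0l ler10 => H; apply: notF; apply: H => s.
    by rewrite dotp0l ler10.
  by move=> ps; exfalso; apply: np; exists s.
pose P s := `[< private g i s >].
have P1 : P s1 by apply/asboolP.
case: (arg_minP (fun s => dotp (g i) (pt s)) P1) => s /asboolP ps smin.
exists s; split=> // t gt.
set mu := dotp (g i) (pt s); have mu1 : 1 <= mu by case: ps.
have mu0 : 0 < mu by exact: lt_le_trans mu1.
have cov u : covers (mu^-1 *: g i) u = (mu <= dotp (g i) (pt u)).
  by rewrite /covers dotpZl mulrC ler_pdivlMr// mul1r.
rewrite -cov; apply: minimal_covering_irreplaceable (gt).
- by apply: AZ; [rewrite invr_ge0 ltW//= invf_le1|have [] := cg].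
- by move=> u; rewrite cov; exact: le_trans.
- by move=> u pu; rewrite cov; apply: smin; apply/asboolP.
Qed.

(** Some [g j] covers the midpoint of [s] and [t]. If [j] is neither [i] nor [k], both values
    average below 1; if [j] is [i], the value at [t] is below 1 and pulls the midpoint below the
    least value, taken at [s]; likewise for [k]. *)
Lemma tight_color_inj i k s t :
  tight g i s -> tight g k t -> col s = col t -> i = k.
Proof.
move=> [[gs ps] ms] [[gt' pt'] mt] /midpoint[p pE].
apply: contrapT => /eqP ik.
have [_ /(_ p)[j gp]] := cg.
have dp : dotp (g j) (pt p) = 2^-1 * (dotp (g j) (pt s) + dotp (g j) (pt t)).
  by rewrite pE dotpZr dotpDr.
have [ji|ji] := eqVneq j i.
  have := ms p; rewrite -ji => /(_ gp).
  move: gs (pt' j); rewrite -ji ji ik -ji -ltNge => + /(_ isT).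
  by rewrite /covers in gp *; rewrite dp; lra.
have [jk|jk] := eqVneq j k.
  have := mt p; rewrite -jk => /(_ gp).
  move: gt' (ps j); rewrite -jk jk eq_sym ik -jk -ltNge => + /(_ isT).
  by rewrite /covers in gp *; rewrite dp; lra.
move: (ps _ ji) (pt' _ jk) gp; rewrite /covers -!ltNge dp; lra.
Qed.

End Minimal.

(* The parity argument of Doignon, Bell and Scarf: in a covering with the least
   number of incidences, every vector in use takes its least value on the points
   it covers at a point covered by no other vector, and two such points of the
   same colour would have an uncovered midpoint. *)
Lemma midpoint_covering :
  (forall s, exists2 a, A a & 1 <= dotp a (pt s)) ->
  exists c : C -> 'rV[R]_n,
    (forall e, A (c e)) /\ forall s, exists e, 1 <= dotp (c e) (pt s).
Proof.
move=> covA.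
have /choice[f fP] s : exists a, A a /\ covers a s.
  by have [a] := covA s; exists a.
have [|g cg gmin] := @minimal_covering f.
  by split=> [i|s]; [have [] := fP i|exists s; have [] := fP s].
have /choice[c cP] e : exists a, A a /\
    forall i s, tight g i s -> col s = e -> a = g i.
  have [[i [s [ts se]]]|no] := pselect (exists i s, tight g i s /\ col s = e).
    exists (g i); split=> [|k t tk te]; first by have [] := cg.
    by congr g; apply: (tight_color_inj cg ts tk); rewrite se.
  by exists 0; split=> // i s ts se; exfalso; apply: no; exists i, s.
exists c; split=> [e|s]; first by have [] := cP e.
have [_ /(_ s)[i gs]] := cg.
have [t ti] := minimal_covering_tight cg gmin (ex_intro _ s gs).
by exists (col t); have [_ /(_ i t ti erefl) ->] := cP (col t).
Qed.

End MidpointCovering.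

(** * Convex sets with empty interior lie in a hyperplane *)

Lemma rows_col_mx (T : Type) (m1 m2 n : nat) (P : 'rV[T]_n -> Prop)
    (A : 'M[T]_(m1, n)) (B : 'M[T]_(m2, n)) :
  (forall i, P (row i A)) -> (forall i, P (row i B)) ->
  forall i, P (row i (col_mx A B)).
Proof.
by move=> PA PB i; have [j ->|j ->] := split_ordP i; rewrite ?rowKu ?rowKd.
Qed.

Lemma row_free_col_mx (F : fieldType) (m n : nat) (v : 'rV[F]_n)
    (M : 'M[F]_(m, n)) :
  row_free M -> ~~ (v <= M)%MS -> row_free (col_mx v M).
Proof.
move=> fM vM; apply: inj_row_free => u; rewrite -[u]hsubmxK mul_row_col.
set a := lsubmx u; set b := rsubmx u; rewrite [a]mx11_scalar mul_scalar_mx.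
have [->|a0] := eqVneq (a 0 0) 0.
  rewrite scale0r add0r => /eqP; rewrite mulmx_free_eq0// => /eqP ->.
  by rewrite raddf0 row_mx0.
move=> abM; case/negP: vM.
have -> : v = (- (a 0 0)^-1 *: b) *m M.
  rewrite -scalemxAl -[b *m M]opprK -(addr0_eq abM) opprK.
  by rewrite scaleNr -scalerN opprK scalerA mulVf// scale1r.
exact: submxMl.
Qed.

Section FlatConvexSets.
Context {R : realType} {n : nat}.
Implicit Types (K : set 'rV[R]_n).

Lemma convex_combination K (m : nat) (w : 'I_m -> R) (x : 'I_m -> 'rV[R]_n) :
  convex_set K -> (forall i, K (x i)) -> (forall i, 0 <= w i) ->
  \sum_(i < m) w i = 1 -> K (\sum_(i < m) w i *: x i).
Proof.
move=> cK; elim: m w x => [|m IHm] w x xK w0.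
  by rewrite big_ord0 => /eqP; rewrite eq_sym oner_eq0.
rewrite !big_ord_recl; set W := \sum_(i < m) w (lift ord0 i) => w1.
have W0 : 0 <= W by apply: sumr_ge0.
have [WE|Wn0] := eqVneq W 0.
  rewrite big1 => [|i _]; first by rewrite addr0 -[w _]addr0 -WE w1 scale1r.
  have /eqP := WE; rewrite psumr_eq0// => /allP /(_ i).
  by rewrite mem_index_enum => /(_ isT)/eqP ->; rewrite scale0r.
have Wp : 0 < W by rewrite lt_def Wn0.
have -> : \sum_(i < m) w (lift ord0 i) *: x (lift ord0 i) =
    (1 - w ord0) *: \sum_(i < m) (w (lift ord0 i) / W) *: x (lift ord0 i).
  rewrite -w1 addrAC subrr add0r scaler_sumr; apply: eq_bigr => i _.
  by rewrite scalerA mulrC divfK.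
apply: convex_segment => //; last first.
  by rewrite w0 -w1 lerDl.
apply: IHm => [//|i|]; first by rewrite divr_ge0.
by rewrite -mulr_suml divff.
Qed.

(** [K] contains a nondegenerate simplex; near its barycentre all barycentric coordinates stay
    positive. *)
Lemma interior_simplex K x0 (M : 'M[R]_n) : convex_set K -> K x0 ->
  M \in unitmx -> (forall i, K (x0 + row i M)) -> interior K !=set0.
Proof.
move=> cK Kx0 uM MK.
(* The common weight of the [n.+1] vertices, so that [c] below is the barycentre. *)
pose t : R := n.+1%:R^-1.
have t0 : 0 < t by rewrite invr_gt0 ltr0n.
pose u x : 'rV[R]_n := (x - x0) *m invmx M.
pose c := x0 + (const_mx t : 'rV[R]_n) *m M.
have uE : u c = const_mx t.
  by rewrite /u /c addrAC subrr add0r mulmxK.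
exists c.
pose q j := (col j (invmx M))^T.
have qE x j : dotp (q j) x - dotp (q j) x0 = u x 0 j.
  by rewrite -dotpBr dotp_trcol.
have sumE x : \sum_j u x 0 j = dotp (\sum_j q j) x - dotp (\sum_j q j) x0.
  rewrite -dotpBr dotpC /dotp.
  under [RHS]eq_bigr do rewrite summxE mulr_sumr.
  rewrite exchange_big /=; apply: eq_bigr => j _.
  by rewrite -dotp_trcol dotpC.
have near_pos : \forall x \near c, forall j, 0 < u x 0 j.
  apply: (@filter_forall _ _ _ _ (nbhs_filter c)) => j.
  have : dotp (q j) x0 < dotp (q j) c by rewrite -subr_gt0 qE uE mxE.
  by move=> /near_dotp_gt; apply: filterS => x; rewrite -qE subr_gt0.
have near_sum : \forall x \near c, \sum_j u x 0 j < 1.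
  have : dotp (\sum_j q j) c < 1 + dotp (\sum_j q j) x0.
    rewrite -ltrBlDr -sumE uE; under eq_bigr do rewrite mxE.
    rewrite sumr_const card_ord -mulr_natl ltr_pdivrMr ?ltr0n// mul1r.
    by rewrite ltr_nat.
  by move=> /near_dotp_lt; apply: filterS => x; rewrite sumE ltrBlDr.
rewrite /interior.
apply: (@filterS2 _ _ (nbhs_filter c) _ _ _ _ near_pos near_sum) => x xp xs.
(* Index 0 stands for the vertex [x0], which receives the remaining weight. *)
pose w (i : 'I_n.+1) := oapp (u x 0) (1 - \sum_j u x 0 j) (unlift ord0 i).
pose y (i : 'I_n.+1) := oapp (fun i => x0 + row i M) x0 (unlift ord0 i).
have -> : x = \sum_(i < n.+1) w i *: y i.
  rewrite big_ord_recl {1}/w {1}/y !unlift_none /=.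
  have e i : w (lift ord0 i) *: y (lift ord0 i) =
      u x 0 i *: x0 + u x 0 i *: row i M.
    by rewrite /w /y liftK /= scalerDr.
  rewrite (eq_bigr _ (fun i _ => e i)) big_split /= -scaler_suml.
  rewrite addrA -scalerDl subrK scale1r.
  rewrite -mulmx_sum_row /u mulmxKV// addrC subrK//.
apply: convex_combination => // [i|i|].
- by rewrite /y; case: unliftP => [j _|_] /=.
- rewrite /w; case: unliftP => [j _|_] /=; first exact: ltW.
  by rewrite subr_ge0 ltW.
- rewrite big_ord_recl {1}/w unlift_none /=.
  have e i : w (lift ord0 i) = u x 0 i by rewrite /w liftK.
  by rewrite (eq_bigr _ (fun i _ => e i)) subrK.
Qed.

(** Independent differences [x - x0] are collected one at a time. With [n] of them [K] would contain
    a full simplex; if the process stops earlier, all differences lie in the row space of [M], and a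
    nonzero column of its cokernel is a normal. *)
Lemma flat_convex_set K : (0 < n)%N -> convex_set K -> interior K = set0 ->
  exists c d, c != 0 /\ forall x, K x -> dotp c x = d.
Proof.
move=> n0 cK iK.
have [K0|/set0P[x0 Kx0]] := eqVneq K set0.
  exists (const_mx 1), 0; split=> [|x]; last by rewrite K0.
  by apply/eqP => /rowP /(_ (Ordinal n0)) /eqP; rewrite !mxE oner_eq0.
apply: contrapT => nc.
have H k : (k <= n)%N -> exists2 M : 'M[R]_(k, n), row_free M &
    forall i, K (x0 + row i M).
  elim: k => [_|k IHk kn].
    by exists 0 => [|[]//]; rewrite /row_free mxrank0.
  have [M fM MK] := IHk (ltnW kn).
  have [[x Kx xM]|no] := pselect (exists2 x, K x & ~~ (x - x0 <= M)%MS).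
    exists (col_mx (x - x0 : 'rV[R]_n) M : 'M[R]_(1 + k, n)).
      exact: row_free_col_mx fM xM.
    have xK i : K (x0 + row i (x - x0)) by rewrite ord1 row_id addrC subrK.
    exact: (@rows_col_mx R 1 k n (fun v => K (x0 + v)) _ _ xK MK).
  exfalso; apply: nc.
  have : cokermx M != 0.
    by rewrite -mxrank_eq0 mxrank_coker subn_eq0 -ltnNge (eqP fM).
  move=> /eqP cM.
  have [j cj] : exists j, col j (cokermx M) != 0.
    apply: contrapT => n0'; apply: cM; apply/matrixP => i j; rewrite mxE.
    apply: contrapT => ij; apply: n0'; exists j; apply: contra_notN ij.
    by move=> /eqP /colP /(_ i); rewrite !mxE.
  exists (col j (cokermx M))^T, (dotp (col j (cokermx M))^T x0).
  split=> [|x Kx]; first by rewrite trmx_eq0.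
  apply/eqP; rewrite -subr_eq0 -dotpBr dotp_trcol.
  have : (x - x0 <= M)%MS.
    by apply: contrapT => /negP xM; apply: no; exists x.
  by rewrite submxE => /eqP ->; rewrite mxE.
have [M fM MK] := H n (leqnn n).
have : interior K !=set0.
  by apply: (interior_simplex cK Kx0 _ MK); rewrite -row_free_unit.
by rewrite iK => -[].
Qed.

End FlatConvexSets.

(** * Finite intersections of halfspaces *)

Section Halfspaces.
Context {R : realType} {n : nat} {I : finType}.
Variables (a : I -> 'rV[R]_n) (d : I -> R).

Let P := [set x | forall i, dotp (a i) x <= d i].

Lemma closed_halfspaces : closed P.
Proof.
have -> : P = \bigcap_(i in [set: I]) [set x | dotp (a i) x <= d i].
  by apply/seteqP; split=> [x Px i _|x Px i]; exact: Px.
by apply: closed_bigI => i _; exact: closed_halfspace.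
Qed.

Lemma convex_halfspaces : convex_set P.
Proof.
apply: segment_convex => x y t Px Py /andP[t0 t1] i.
rewrite dotpDr !dotpZr (_ : d i = t * d i + (1 - t) * d i); last by ring.
by rewrite lerD// ler_wpM2l ?subr_ge0.
Qed.

Lemma interior_halfspaces x : (forall i, dotp (a i) x < d i) -> interior P x.
Proof.
move=> ax; rewrite /interior.
have : \forall y \near x, forall i, dotp (a i) y < d i.
  apply: (@filter_forall _ _ _ _ (nbhs_filter x)) => i.
  exact: near_dotp_lt.
by apply: (@filterS _ _ (nbhs_filter x)) => y ay i; exact: ltW.
Qed.

Lemma polyhedron_halfspaces : polyhedron P.
Proof.
exists #|I|, (a \o enum_val), (d \o enum_val); apply/seteqP.
split=> x Px i /=; first exact: Px.
by have := Px (enum_rank i); rewrite /= enum_rankK.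
Qed.

End Halfspaces.

(** * Use of maximality, and the case of empty interior *)

Section MaximalSFree.
Context {R : realType} {n : nat}.
Implicit Types (S K : set 'rV[R]_n).

(** Reduces polyhedrality of [K] to finding an S-free polyhedron that contains it. *)
Lemma maximal_S_free_eq S K L :
  maximal_S_free S K -> S_free S L -> K `<=` L -> K = L.
Proof.
move=> [_ Kmax] SL KL; apply/seteqP; split=> //.
by apply: contrapT => LK; apply: Kmax; exists L.
Qed.

(** The hyperplane around [K], written as two opposite halfspaces, has no interior point since
    moving along its normal leaves it; so it is S-free and equals [K]. *)
Lemma flat_maximal_S_free_polyhedron S K : (0 < n)%N ->
  maximal_S_free S K -> interior K = set0 -> polyhedron K.
Proof.
move=> n0 mK iK; have [[_ cK _] _] := mK.
have [c [d [c0 Kd]]] := flat_convex_set n0 cK iK.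
pose a (b : bool) := if b then c else - c.
pose e (b : bool) := if b then d else - d.
pose H := [set x | forall b, dotp (a b) x <= e b].
have HE x : H x -> dotp c x = d.
  move=> Hx; apply/eqP; rewrite eq_le (Hx true)/=.
  by have := Hx false; rewrite /= dotpNl lerN2.
rewrite (_ : K = H); first exact: polyhedron_halfspaces.
apply: (maximal_S_free_eq mK); last first.
  by move=> x /Kd xd [] /=; rewrite ?dotpNl xd.
split; [exact: closed_halfspaces|exact: convex_halfspaces|].
apply/seteqP; split=> // x [iHx _].
have [t t0 tH] := interior_line c iHx.
have /HE : H (x + t *: c) by apply: tH; rewrite ger0_norm// ltW.
have /HE xd : H x by exact: interior_subset iHx.
rewrite dotpDr dotpZr xd => xe; have := mulr_gt0 t0 (dotp_gt0 c0); lra.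
Qed.

End MaximalSFree.

(** For [B] in a finer proper filter [G], the preimage of [B] or of its complement is in [F]; the
    latter would put both [B] and its complement in [G]. *)
Lemma ultra_fmap (T U : Type) (f : T -> U) (F : set_system T) :
  UltraFilter F -> UltraFilter (fmap f F).
Proof.
move=> UF; split=> [|G PG FG]; first exact: fmap_proper_filter.
apply/seteqP; split=> // B GB.
have [//|nB] := in_ultra_setVsetC (f @^-1` B) UF.
have /filter_ex[x []] : G (B `&` ~` B) by apply: filterI => //; exact: FG.
by [].
Qed.

(** * Lattice points in boxes, and the case of nonempty interior *)

Section LatticeFree.
Context {R : realType} {n : nat}.
Variable b : 'rV[R]_n.
Implicit Types K : set 'rV[R]_n.

(** The integer cube from [-N] to [N] shifted by [b], coded by offsets from 0 to [2N] so that its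
    index type is finite. *)
Definition lattice_box (N : nat) (k : {ffun 'I_n -> 'I_N.*2.+1}) : 'rV[R]_n :=
  b + \row_j ((k j)%:R - N%:R).

Lemma lattice_box_in N k : translated_lattice b (@lattice_box N k).
Proof.
exists (\row_j ((k j)%:R - N%:R)) => //; apply/mxOverP => i j.
by rewrite mxE rpredB// intr_nat.
Qed.

Lemma lattice_box_exhausts s : translated_lattice b s ->
  exists N0, forall N, (N0 <= N)%N -> exists k, @lattice_box N k = s.
Proof.
move=> [z /mxOverP zZ <-].
have /choice[m mE] (j : 'I_n) : exists m : int, z 0 j = m%:~R.
  by have /intrP := zZ 0 j.
exists (\sum_j absz (m j))%N => N mN.
have mjN j : (absz (m j) <= N)%N.
  by apply: leq_trans mN; rewrite (bigD1 j)//= leq_addr.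
exists [ffun j => inord (absz (m j + N%:Z))].
congr (b + _); apply/rowP => j; rewrite mxE ffunE mE.
have mN0 : (0 <= m j + N%:Z)%R by have := mjN j; lia.
rewrite inordK; last by have := mjN j; lia.
rewrite -[(absz _)%:R]/((Posz (absz (m j + N%:Z)))%:~R) gez0_abs// intrD.
by rewrite addrK.
Qed.

(** Offsets of equal parity have an even sum, so half of it is again an offset. *)
Lemma lattice_box_midpoint N (k l : {ffun 'I_n -> 'I_N.*2.+1}) :
  [ffun j => odd (k j)] = [ffun j => odd (l j)] ->
  exists p : {ffun 'I_n -> 'I_N.*2.+1},
    lattice_box p = 2^-1 *: (lattice_box k + lattice_box l).
Proof.
move=> /ffunP kl.
exists [ffun j => inord ((k j + l j)./2)].
apply/rowP => j; rewrite !mxE ffunE.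
have := kl j; rewrite !ffunE => klj.
have lt : ((k j + l j)./2 < N.*2.+1)%N.
  by have := ltn_ord (k j); have := ltn_ord (l j); lia.
rewrite inordK//.
have e : ((k j + l j)./2)%:R * 2 = (k j)%:R + (l j)%:R :> R.
  rewrite -natrM muln2 -natrD; congr _%:R.
  by have := odd_double_half (k j + l j); rewrite oddD klj addbb add0n.
rewrite -(mulfK (x := 2 : R) _ ((k j + l j)./2)%:R) ?pnatr_eq0// e.
by field.
Qed.

Lemma full_maximal_lattice_free_polyhedron K x0 :
  maximal_S_free (translated_lattice b) K -> interior K x0 -> polyhedron K.
Proof.
move=> mK ix; have [[clK cvK fK] _] := mK.
(* Dilating by lam N > 1 about x0 moves the lattice points on the boundary of K
   out of K, where they can be separated; lam N tends to 1. *)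
pose lam (N : nat) : R := 1 + N.+1%:R^-1.
have lam1 N : 1 < lam N by rewrite ltrDl invr_gt0 ltr0n.
have lamc : lam @ \oo --> (1:R).
  rewrite -[X in _ --> X]addr0.
  by apply: cvgD; [exact: cvg_cst|exact: cvg_harmonic].
(* The parity classes are the colours; their number does not depend on [N], so limits of the tuples
   make sense. *)
pose C : finType := {ffun 'I_n -> bool}.
have cover N : exists c : C -> 'rV[R]_n, (forall e, polar_at K x0 (c e)) /\
    forall k, exists e, 1 <= lam N * dotp (c e) (@lattice_box N k - x0).
  pose pt k := lam N *: (@lattice_box N k - x0).
  have [|||c [cA cc]] := @midpoint_covering _ _ _ C pt
    (fun k => [ffun j => odd (k j)]) (polar_at K x0) (@polar_at0 _ _ _ _).
  - by move=> a t; exact: polar_atZ.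
  - move=> k l /lattice_box_midpoint[p pE]; exists p.
    by rewrite /pt pE; apply/rowP => j; rewrite !mxE; field.
  (* Otherwise the lattice point would lie strictly between the interior point [x0] and a point of
     [K], hence in the interior of [K]. *)
  - move=> k; have Kpt : ~ K (x0 + pt k).
      move=> Kpt; suff : set0 (lattice_box k) by [].
      rewrite -fK; split; last exact: lattice_box_in.
      have lam0 : 0 < lam N by exact: lt_trans (lam1 N).
      have lamn0 : lam N != 0 by rewrite gt_eqF.
      have -> : lattice_box k =
          (lam N)^-1 *: (x0 + pt k) + (1 - (lam N)^-1) *: x0.
        by apply/rowP => j; rewrite /pt !mxE; field.
      apply: interior_segment => //.
      by rewrite invr_ge0 ltW//= invf_lt1.
    have [a aA] := polar_at_separates clK cvK ix Kpt.
    by rewrite addrC addKr; exists a.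
  exists c; split=> // k; have [e ce] := cc k.
  by exists e; rewrite -dotpZr.
have /choice[c cP] := cover.
(* Along one ultrafilter finer than [\oo], all components of the tuples converge at once, without
   extracting subsequences. *)
have [U [UU ooU]] := ultraFilterLemma (@eventually_filter).
have UF : Filter U by apply: filter_filter.
have /choice[a aP] (e : C) : exists a, polar_at K x0 a /\ c ^~ e @ U --> a.
  have := @polar_at_compact _ _ K x0 ix; rewrite compact_ultra /=.
  move=> /(_ (fmap (c ^~ e) U) (ultra_fmap _ _))[|a [aK ca]]; last by exists a.
  apply: (@filterE _ U _ (fun N => polar_at K x0 (c N e))) => N.
  by have [] := cP N.
pose P := [set x | forall e, dotp (a e) x <= 1 + dotp (a e) x0].
rewrite (_ : K = P); first exact: polyhedron_halfspaces.
apply: (maximal_S_free_eq mK); last first.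
  move=> x Kx e; have [aK _] := aP e.
  by have := aK _ Kx; rewrite dotpBr lerBlDr.
split; [exact: closed_halfspaces|exact: convex_halfspaces|].
apply/seteqP; split=> // s [iPs Ss].
(* Strict, because [s] can be pushed slightly away from [x0] within [P]. *)
have as1 e : dotp (a e) (s - x0) < 1.
  have [t t0 tP] := interior_line (s - x0) iPs.
  have Pt : P (s + t *: (s - x0)) by apply: tP; rewrite ger0_norm// ltW.
  have Ps : P s by exact: interior_subset iPs.
  have := Pt e; have := Ps e.
  rewrite dotpDr dotpZr !dotpBr; set u := dotp _ s; set v := dotp _ x0.
  by nra.
(* The strict bound passes from the limit to some tuple [c N] whose box contains [s], against the
   choice of [c N]. *)
have near_lt : \forall N \near U, forall e, lam N * dotp (c N e) (s - x0) < 1.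
  apply: filter_forall => e; have [_ ca] := aP e.
  apply: (@cvgr_lt R _ U _ _ (1 * dotp (a e) (s - x0))); last by rewrite mul1r.
  apply: cvgM.
    exact: cvg_trans (cvg_app _ ooU) lamc.
  by apply: (cvg_dotp ca); exact: cvg_cst.
have [N0 boxE] := lattice_box_exhausts Ss.
have near_ge : \forall N \near U, (N0 <= N)%N.
  by apply: ooU; exact: nbhs_infty_ge.
have [N [lt1 /boxE[k kE]]] := filter_ex (filterI near_lt near_ge).
have [_ /(_ k)[e]] := cP N.
by rewrite kE leNgt lt1.
Qed.

(** If all products were negative, a far point [T *: r] would be so deep in the set that rounding it
    to the lattice stays inside. For empty [I] the set is the whole space, so an index is obtained
    in any case. *)
Lemma lattice_free_halfspaces_ge0 {I : finType} (a : I -> 'rV[R]_n) r :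
  interior [set x | forall i, dotp (a i) x <= 1] `&` translated_lattice b
    = set0 ->
  exists i, 0 <= dotp (a i) r.
Proof.
move=> fP; apply: contrapT => nr.
have r0 i : dotp (a i) r < 0.
  by rewrite ltNge; apply: contra_notN nr => ?; exists i.
(* Bounds the change in [dotp (a i)] when [T *: r] is rounded down and shifted by [b]. *)
pose M i := \sum_j `|a i 0 j| * (`|b 0 j| + 1).
have M0 i : 0 <= M i by apply: sumr_ge0 => j _; rewrite mulr_ge0// addr_ge0.
(* The terms are nonnegative, so the sum dominates each of them and serves all [i] at once. *)
pose T := \sum_i (M i / - dotp (a i) r).
have TM i : M i + T * dotp (a i) r <= 0.
  have : M i / - dotp (a i) r <= T.
    rewrite /T (bigD1 i)//= lerDl sumr_ge0// => k _.
    by rewrite divr_ge0// oppr_ge0 ltW.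
  by rewrite ler_pdivrMr ?oppr_gt0// mulrN; lra.
pose z : 'rV[R]_n := \row_j (Num.floor (T * r 0 j))%:~R.
suff : set0 (b + z) by [].
rewrite -fP; split; last first.
  by exists z => //; apply/mxOverP => i j; rewrite mxE intr_int.
apply: interior_halfspaces => i.
rewrite -[b + z](subrK (T *: r)) addrC.
rewrite dotpDr dotpZr; apply: le_lt_trans ltr01.
apply: le_trans (TM i); rewrite addrC lerD2r.
apply: ler_sum => j _; apply: (le_trans (ler_norm _)); rewrite normrM.
rewrite ler_wpM2l// !mxE -addrA (le_trans (ler_normD _ _))// lerD2l.
have /andP[f1 f2] := floor_itv (T * r 0 j); rewrite intrD in f2.
by rewrite ler_norml; apply/andP; split; lra.
Qed.

End LatticeFree.

(** * The gauge formula and the conclusion *)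

Lemma gauge_halfspaces {R : realType} {n : nat} {I : finType}
    (a : I -> 'rV[R]_n) (r : 'rV[R]_n) (i0 : I) :
  0 <= dotp (a i0) r -> (forall i, dotp (a i) r <= dotp (a i0) r) ->
  gauge [set x | forall i, dotp (a i) x <= 1] r = dotp (a i0) r.
Proof.
move=> m0 mmax; set m := dotp (a i0) r in m0 mmax *.
have E : [set t : R | 0 < t /\ forall i, dotp (a i) (t^-1 *: r) <= 1] =
    [set t | 0 < t /\ m <= t].
  apply/seteqP; split=> t /= [t0 tr]; split=> //.
    by have := tr i0; rewrite dotpZr mulrC ler_pdivrMr// mul1r.
  by move=> i; rewrite dotpZr mulrC ler_pdivrMr// mul1r (le_trans (mmax i)).
rewrite /gauge /= E; apply/eqP; rewrite eq_le; apply/andP; split.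
  (* If [m] is 0 it is not itself in the set, so the infimum is compared with [m + e]. *)
  apply/ler_addgt0Pr => e e0; apply: ge_inf.
    by exists m => t [].
  by split; [rewrite ltr_wpDl|rewrite lerDl ltW].
apply: lb_le_inf => [|t []//].
by exists (m + 1); split; [rewrite ltr_wpDl|rewrite lerDl].
Qed.

Theorem theorem4p5 (R : realType) (n : nat) (b : 'rV[R]_n)
    (hb : ~ Zvec b) :
  (forall K : set 'rV[R]_n,
     maximal_S_free (translated_lattice b) K -> polyhedron K) /\
  (forall (K : set 'rV[R]_n) (I : finType) (a : I -> 'rV[R]_n),
     maximal_S_free (translated_lattice b) K ->
     interior K 0 ->
     K = [set x | forall i : I, dotp (a i) x <= 1] ->
     forall r : 'rV[R]_n,
       is_max [set dotp (a i) r | i in [set: I]] (gauge K r)).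
Proof.
(* In dimension 0 every vector is vacuously integral, against [hb]. *)
have n0 : (0 < n)%N.
  rewrite lt0n; apply/eqP => n0; apply: hb; apply/mxOverP => i j.
  by move: (ltn_ord j); rewrite [X in (_ < X)%N]n0.
split=> [K mK|K I a [[_ _ fK] _] _ KE r].
  have [K0|/set0P[x0 ix]] := eqVneq (interior K) set0.
    exact: flat_maximal_S_free_polyhedron n0 mK K0.
  exact: full_maximal_lattice_free_polyhedron mK ix.
(* The index [i1] shows both that a maximiser exists and that the maximum is nonnegative. *)
rewrite KE in fK *; have [i1 i1r] := lattice_free_halfspaces_ge0 r fK.
case: (@arg_maxP _ _ _ i1 predT (fun i => dotp (a i) r) isT) => i0 _ i0max.
rewrite (@gauge_halfspaces _ _ _ _ _ i0); last first.
- by move=> i; exact: i0max.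
- exact: le_trans (i0max i1 isT).
by split=> [|_ [i _ <-]]; [exists i0|exact: i0max].
Qed.
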